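(* The uniform small-ball-to-Gaussian-width assertion (defined in the context) is false for $(\alpha,\beta)=(1/\sqrt2,1/12)$. More concretely, for every integer $n\ge1$, with $p=4^n+1$, there exist a closed polyhedral convex cone $C\subset\mathbb{R}^p$, with $A=C\cap\mathbb{S}^{p-1}$, and a centered random vector $Z\in\mathbb{R}^p$ such that $Z$ has finite covariance, polynomial tails (in every standard coordinate) and an infinite fourth moment in every standard coordinate, $\inf_{v\in\mathbb{R}^p\setminus\{0\}}\mathbb{P}(|\langle Z,v\rangle|\ge\|v\|_2/\sqrt2)\ge 1/12$, $w(A)<2$, and, when $X\in\mathbb{R}^{n\times p}$ has $n$ independent copies of $Z$ as rows, $\mathbb{P}(\inf_{u\in A}\|Xu\|_2^2=0)\ge1-\exp(-2^n)$; and for these examples the following holds: for every fixed $c_1,c_2>0$, whenever $n>4c_2/c_1$, the inequality $$\inf_{u\in A}\|Xu\|_2^2\ge c_1n-c_2w(A)^2$$ fails with probability at least $1-\exp(-2^n)$.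
   Context: $\mathbb{S}^{p-1}=\{u\in\mathbb{R}^p:\|u\|_2=1\}$. For $A\subset\mathbb{S}^{p-1}$, the (one-sided) Gaussian width is $w(A):=\mathbb{E}\sup_{u\in A}\langle g,u\rangle$ with $g\sim N(0,I_p)$. A closed polyhedral convex cone is the set of all nonnegative linear combinations of finitely many vectors. A random vector $Z$ has polynomial tails (in every standard coordinate) if for each coordinate $Z_k$ there are constants $0<c\le c'<\infty$, $\kappa>0$, $t_0>0$ (possibly depending on $k$ and on the law of $Z$) with $c\,t^{-\kappa}\le\mathbb{P}(|Z_k|\ge t)\le c'\,t^{-\kappa}$ for all $t\ge t_0$. Uniform small-ball-to-Gaussian-width assertion for fixed $\alpha,\beta>0$: there are constants $c_1=c_1(\alpha,\beta)>0$, $c_2=c_2(\alpha,\beta)>0$ and a sequence $q_n=q_n(\alpha,\beta)\to0$ such that the following holds simultaneously for every $n,p$, every random vector $Z\in\mathbb{R}^p$ satisfying $\inf_{v\in\mathbb{R}^p\setminus\{0\}}\mathbb{P}(|\langle Z,v\rangle|\ge\alpha\|v\|_2)\ge\beta$, and every $A\subset\mathbb{S}^{p-1}$: if the rows of $X\in\mathbb{R}^{n\times p}$ are independent copies of $Z$, then $$\mathbb{P}\left(\inf_{u\in A}\|Xu\|_2^2\ge c_1n-c_2w(A)^2\right)\ge1-q_n.$$ *)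

(* Defs.v *)
From HB Require Import structures.
From mathcomp Require Import all_boot all_order all_algebra.
From mathcomp Require Import all_classical all_reals all_analysis.
Set Implicit Arguments.
Unset Strict Implicit.
Unset Printing Implicit Defensive.
Import Order.TTheory GRing.Theory Num.Theory.
Import numFieldNormedType.Exports.
Local Open Scope classical_set_scope.
Local Open Scope ring_scope.

(* R^p is 'rV[R]_p, with the product (equivalently, Borel) sigma-algebra. *)
Section row_measurable.
Context {R : realType} {p : nat}.

Let coord (i : 'I_p) (v : 'rV[R]_p) : R := v ord0 i.

Let row_set0 : g_sigma_preimage coord set0.
Proof. exact: sigma_algebra0. Qed.

Let row_setC A : g_sigma_preimage coord A -> g_sigma_preimage coord (~` A).
Proof. exact: sigma_algebraC. Qed.

Let row_bigcup (F : (set 'rV[R]_p)^nat) :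
  (forall i, g_sigma_preimage coord (F i)) ->
  g_sigma_preimage coord (\bigcup_i (F i)).
Proof. exact: sigma_algebra_bigcup. Qed.

HB.instance Definition _ := @isMeasurable.Build default_measure_display 'rV[R]_p
  (g_sigma_preimage coord) row_set0 row_setC row_bigcup.

Lemma measurable_coord (i : 'I_p) :
  measurable_fun [set: 'rV[R]_p] (fun v : 'rV[R]_p => v ord0 i).
Proof.
move=> _ Y mY; rewrite setTI; apply: sub_sigma_algebra => /=.
rewrite -bigcup_seq/=; exists i => /=; first by rewrite mem_index_enum.
by exists Y => //; rewrite setTI.
Qed.

Lemma measurable_fun_rowP d (T : measurableType d) (f : T -> 'rV[R]_p) :
  measurable_fun [set: T] f <->
  forall i, measurable_fun [set: T] (fun x => f x ord0 i).
Proof.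
split=> [mf i|mf].
  exact: (measurableT_comp (measurable_coord i) mf).
apply: (@measurability _ _ T 'rV[R]_p setT f
  (\big[setU/set0]_(i < p) preimage_set_system setT (coord i) measurable))
  => //.
move=> _ [C + <-]; rewrite -bigcup_seq => -[i _ [A mA <-]].
rewrite !setTI.
have := mf i measurableT A mA.
by rewrite setTI.
Qed.

End row_measurable.

Section std_gaussian.
Context {R : realType}.

Definition row_cons (n : nat) (x : measurableTypeR R * 'rV[R]_n) :
  'rV[R]_n.+1 := \row_i (if unlift ord0 i is Some j then x.2 ord0 j else x.1).

Lemma row_cons0 n x : @row_cons n x ord0 ord0 = x.1.
Proof. by rewrite mxE unlift_none. Qed.

Lemma row_consS n x (j : 'I_n) : row_cons x ord0 (lift ord0 j) = x.2 ord0 j.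
Proof. by rewrite mxE liftK. Qed.

Lemma measurable_row_cons n : measurable_fun setT (@row_cons n).
Proof.
apply/measurable_fun_rowP => i.
case: (unliftP ord0 i) => [j ->|->].
  rewrite (_ : (fun _ => _) = (fun v : 'rV[R]_n => v ord0 j) \o snd).
    by apply: measurableT_comp => //; exact: measurable_coord.
  by apply/funext => x; rewrite row_consS.
rewrite (_ : (fun _ => _) = fst); first exact: measurable_fst.
by apply/funext => x; rewrite row_cons0.
Qed.

HB.instance Definition _ n := isMeasurableFun.Build _ _ _ _ (@row_cons n)
  (@measurable_row_cons n).

(* The law N(0, I_n): the n-fold product of the standard normal law. *)
Fixpoint std_gaussian (n : nat) : probability 'rV[R]_n R :=
  match n with
  | 0 => \d_(0 : 'rV[R]_0)
  | n'.+1 => distribution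
      (normal_prob (0 : R) 1 \x std_gaussian n')%E (@row_cons n')
  end.

Lemma std_gaussian_rect n (B : 'I_n -> set R) :
  (forall i, measurable (B i)) ->
  std_gaussian n [set v : 'rV[R]_n | forall i, B i (v ord0 i)] =
  (\prod_(i < n) normal_prob 0 1 (B i))%E.
Proof.
elim: n B => [|n IH] B mB /=.
  by rewrite big_ord0 diracE mem_set// => -[].
rewrite big_ord_recl /distribution /pushforward -(IH (B \o lift ord0))//.
set C := [set v : 'rV[R]_n | forall i, (B \o lift ord0) i (v ord0 i)].
have mC : measurable C.
  rewrite (_ : C = \bigcap_(i in [set: 'I_n])
    ((fun v : 'rV[R]_n => v ord0 i) @^-1` B (lift ord0 i))).
    apply: fin_bigcap_measurable => // i _; rewrite -[X in measurable X]setTI.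
    exact: measurable_coord.
  by apply/seteqP; split=> v /=; [move=> h i _; exact: h|move=> h i; exact: h].
rewrite -product_measure1E//.
- congr (_ _); apply/seteqP; split=> -[x v] /= h.
    split=> [|i]; first by have := h ord0; rewrite row_cons0.
    by have := h (lift ord0 i); rewrite row_consS.
  move=> i; case: (unliftP ord0 i) => [j ->|->].
    by rewrite row_consS; exact: h.2.
  by rewrite row_cons0; exact: h.1.
- exact: mB.
- by move=> i; exact: mB.
Qed.

End std_gaussian.

Section euclidean.
Context {R : realType}.

(* Not the canonical norm `|u| of 'rV[R]_p, which is the sup norm. *)
Definition dot (p : nat) (u v : 'rV[R]_p) : R :=
  \sum_(i < p) u ord0 i * v ord0 i.

Definition l2norm (p : nat) (u : 'rV[R]_p) : R := Num.sqrt (dot u u).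

Definition sphere (p : nat) : set 'rV[R]_p := [set u | l2norm u = 1].

(* Values in \bar R: w(A) is a real number unless A is empty, and
   w(set0) = -oo. *)
Definition gaussian_width (p : nat) (A : set 'rV[R]_p) : \bar R :=
  (\int[std_gaussian p]_g ereal_sup [set (dot g u)%:E | u in A])%E.

Definition polyhedral_cone (p : nat) (C : set 'rV[R]_p) : Prop :=
  exists (m : nat) (V : 'I_m -> 'rV[R]_p),
    C = [set x | exists2 a : 'I_m -> R,
                   forall i, 0 <= a i & x = \sum_(i < m) a i *: V i].

(* Vectors being rows, the vector X u is X *m u^T. The infimum is +oo when A is
   empty. *)
Definition inf_sqnorm (n p : nat) (X : 'M[R]_(n, p)) (A : set 'rV[R]_p)
  : \bar R :=
  ereal_inf [set (l2norm (X *m u^T)^T ^+ 2)%:E | u in A].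

Definition width_bound (c1 c2 : R) (n p : nat) (X : 'M[R]_(n, p))
  (A : set 'rV[R]_p) : Prop :=
  ((c1 * n%:R)%:E - c2%:E * gaussian_width A ^+ 2 <= inf_sqnorm X A)%E.

End euclidean.
Arguments sphere {R} p _.

Section random_vectors.
Context {R : realType} {p : nat} {d : measure_display} {T : measurableType d}
  {P : probability T R}.
Implicit Type Z : {RV P >-> 'rV[R]_p}.

Definition centered Z : Prop := forall k : 'I_p,
  P.-integrable setT (EFin \o (fun w => Z w ord0 k)) /\
  ('E_P[(fun w => Z w ord0 k)] = 0)%E.

Definition finite_covariance Z : Prop :=
  (forall k : 'I_p, P.-integrable setT (EFin \o (fun w => Z w ord0 k))) /\
  (forall k l : 'I_p,
    P.-integrable setT (EFin \o (fun w => Z w ord0 k * Z w ord0 l))).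

Definition polynomial_tails Z : Prop := forall k : 'I_p,
  exists c c' kappa t0 : R,
    [/\ 0 < c, c <= c', 0 < kappa, 0 < t0 &
     forall t, t0 <= t ->
       ((c * t `^ (- kappa))%:E <= P [set w | (t <= `|Z w ord0 k|)%R] /\
        P [set w | (t <= `|Z w ord0 k|)%R] <= (c' * t `^ (- kappa))%:E)%E].

Definition infinite_fourth_moments Z : Prop := forall k : 'I_p,
  ('E_P[(fun w => (Z w ord0 k ^+ 4)%R)] = +oo)%E.

Definition small_ball (alpha beta : R) Z : Prop :=
  (beta%:E <= ereal_inf
    [set P [set w | (alpha * l2norm v <= `|dot (Z w) v|)%R]
       | v in [set v : 'rV[R]_p | v != 0%R]])%E.

End random_vectors.

Section iid_copies.
Context {R : realType} {n p : nat}.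

Definition independent_rows d (T : measurableType d) (P : probability T R)
    (X : 'I_n -> {RV P >-> 'rV[R]_p}) : Prop :=
  forall (J : {set 'I_n}) (B : 'I_n -> set 'rV[R]_p),
    (forall i, measurable (B i)) ->
    P (\bigcap_(i in [set` J]) (X i @^-1` B i)) =
    (\prod_(i in J) P (X i @^-1` B i))%E.

(* Independent random vectors X_0, ..., X_{n-1}, each with the law of Z; they
   need not live on the probability space of Z. *)
Definition independent_copies d (T : measurableType d) (P : probability T R)
    (Z : {RV P >-> 'rV[R]_p}) d' (T' : measurableType d')
    (P' : probability T' R) (X : 'I_n -> {RV P' >-> 'rV[R]_p}) : Prop :=
  independent_rows X /\
  forall (i : 'I_n) (B : set 'rV[R]_p), measurable B ->
    distribution P' (X i) B = distribution P Z B.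

Definition rows_mx d (T : measurableType d) (P : probability T R)
    (X : 'I_n -> {RV P >-> 'rV[R]_p}) (w : T) : 'M[R]_(n, p) :=
  \matrix_(i < n) X i w.

End iid_copies.

Definition small_ball_to_width (R : realType) (alpha beta : R) : Prop :=
  exists (c1 c2 : R) (q : R^nat),
    [/\ 0 < c1, 0 < c2, q k @[k --> \oo] --> 0 &
     forall (n p : nat)
            (d : measure_display) (T : measurableType d) (P : probability T R)
            (Z : {RV P >-> 'rV[R]_p}) (A : set 'rV[R]_p)
            (d' : measure_display) (T' : measurableType d')
            (P' : probability T' R) (X : 'I_n -> {RV P' >-> 'rV[R]_p}),
       small_ball alpha beta Z -> A `<=` sphere p -> independent_copies Z X ->
       ((1 - q n)%:E <= P' [set w | width_bound c1 c2 (rows_mx X w) A])%E].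

(* Main.v *)
Require Import Defs.
From HB Require Import structures.
From mathcomp Require Import all_boot all_order all_algebra.
From mathcomp Require Import all_classical all_reals all_analysis.
From mathcomp Require Import finmap measurable_realfun ring lra.
Set Implicit Arguments.
Unset Strict Implicit.
Unset Printing Implicit Defensive.
Import Order.TTheory GRing.Theory Num.Theory.
Import numFieldNormedType.Exports.
Local Open Scope classical_set_scope.
Local Open Scope ring_scope.

(* Let N = 4^n and M = 4N. The vector Z is 2^K (s_0, M s_1, ..., M s_N), with
   independent uniform signs s_k and an independent heavy-tailed radius 2^K,
   P(K >= k) = 8^-k. Only the lower bound on P(|<Z, v>| >= ||v|| / sqrt 2) is
   at stake, so that rescaling by M >= 1 and by 2^K >= 1 is harmless, and the
   small ball property follows from Paley-Zygmund for Rademacher sums.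
   The cone is generated by v_j = e_0 + e_j / M: its points on the sphere are
   within O(1/M) of e_0, so its width is bounded by E|g_0| plus a small error.
   However <Z, v_j> = 2^K (s_0 + s_j) vanishes as soon as the signs differ, so
   X v_j = 0 for some j unless none of the N sign columns is opposite to the
   first one. This has probability (1 - 2^-n)^N <= exp (- 2^n). *)

(** * Rademacher sums *)

Section rademacher.
Context {R : realFieldType} {I : finType}.
Implicit Types (s : {ffun I -> bool}) (i : I) (a : I -> R) (r : seq I).

Definition flip i s : {ffun I -> bool} := [ffun k => s k (+) (k == i)].

Lemma flipK i : involutive (flip i).
Proof. by move=> s; apply/ffunP => k; rewrite !ffunE -addbA addbb addbF. Qed.

Lemma sgn_flip i s : (-1) ^+ flip i s i = - (-1) ^+ s i :> R.
Proof. by rewrite ffunE eqxx addbT signrN. Qed.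

(** The involution [flip i] preserves [g] and negates the sign at [i], so the sum equals its own
    opposite. *)
Lemma sum_sgn_odd i (g : {ffun I -> bool} -> R) :
  (forall s, g (flip i s) = g s) ->
  \sum_(s : {ffun I -> bool}) (-1) ^+ s i * g s = 0.
Proof.
move=> gi; set S := LHS; suff : S = - S by lra.
rewrite {1}/S (reindex_inj (inv_inj (flipK i))) /S -sumrN.
by apply: eq_bigr => s _; rewrite sgn_flip gi mulNr.
Qed.

(** The sum runs over a list so that moments can be computed by induction, peeling off one
    independent sign at a time. *)
Definition sgn_sum a r s : R := \sum_(k <- r) (-1) ^+ s k * a k.

Lemma sgn_sum_flip a r i s : i \notin r ->
  sgn_sum a r (flip i s) = sgn_sum a r s.
Proof.
move=> ir; apply: eq_big_seq => k kr; rewrite ffunE.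
case: eqVneq => [ki|_]; last by rewrite addbF.
by rewrite -ki kr in ir.
Qed.

Lemma sum_sgn_sum2 a r : uniq r ->
  \sum_(s : {ffun I -> bool}) sgn_sum a r s ^+ 2 =
  #|{ffun I -> bool}|%:R * \sum_(k <- r) a k ^+ 2.
Proof.
elim: r => [_|i r IH /= /andP[ir /IH {}IH]].
  by rewrite big_nil mulr0 big1// => s _; rewrite /sgn_sum big_nil expr0n.
have E s : sgn_sum a (i :: r) s ^+ 2 =
    a i ^+ 2 + (-1) ^+ s i * (2 * a i * sgn_sum a r s) + sgn_sum a r s ^+ 2.
  rewrite /sgn_sum big_cons -/(sgn_sum a r s) sqrrD exprMn sqrr_sign mul1r;
    ring.
rewrite (eq_bigr _ (fun s _ => E s)) !big_split/= IH sum_sgn_odd; last first.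
  by move=> s; rewrite sgn_sum_flip.
by rewrite big_cons sumr_const mulrDr addr0 [in RHS]mulr_natl.
Qed.

(** Expanding (±a_i + S)^4, the terms odd in the sign at [i] cancel, leaving a_i^4 + 6 a_i^2 S^2 +
    S^4. With [m] the sum of squares over the tail, the bound 3 (a_i^2 + m)^2 exceeds what is needed
    by 2 a_i^4, up to the number of sign patterns. *)
Lemma sum_sgn_sum4 a r : uniq r ->
  \sum_(s : {ffun I -> bool}) sgn_sum a r s ^+ 4 <=
  3 * #|{ffun I -> bool}|%:R * (\sum_(k <- r) a k ^+ 2) ^+ 2.
Proof.
set K : R := #|_|%:R.
elim: r => [_|i r IH /= /andP[ir ur]].
  rewrite big_nil expr0n mulr0 big1// => s _;
    by rewrite /sgn_sum big_nil expr0n.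
have E s : sgn_sum a (i :: r) s ^+ 4 =
    a i ^+ 4 + 6 * a i ^+ 2 * sgn_sum a r s ^+ 2
    + (-1) ^+ s i * (4 * a i ^+ 3 * sgn_sum a r s + 4 * a i * sgn_sum a r s ^+
        3)
    + sgn_sum a r s ^+ 4.
  rewrite /sgn_sum big_cons -/(sgn_sum a r s).
  by case: (s i); rewrite ?expr1 ?expr0; ring.
rewrite (eq_bigr _ (fun s _ => E s)) !big_split/= sum_sgn_odd; last first.
  by move=> s; rewrite sgn_sum_flip.
have -> : \sum_(s : {ffun I -> bool}) 6 * a i ^+ 2 * sgn_sum a r s ^+ 2 =
    6 * a i ^+ 2 * (K * \sum_(k <- r) a k ^+ 2).
  by rewrite -mulr_sumr sum_sgn_sum2.
rewrite addr0 big_cons sumr_const -[_ *+ #|_|]mulr_natl -/K.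
set m := \sum_(j <- r) _; have K0 : 0 <= K by rewrite ler0n.
have := IH ur; rewrite -/m; set L := \sum_s _ => HL.
have -> : 3 * K * (a i ^+ 2 + m) ^+ 2 =
  3 * K * m ^+ 2 + K * a i ^+ 4 + 6 * a i ^+ 2 * (K * m) + 2 * (K * a i ^+ 4).
  ring.
have : 0 <= 2 * (K * a i ^+ 4).
  by rewrite mulr_ge0// mulr_ge0// exprn_even_ge0.
lra.
Qed.

(* Paley-Zygmund at level 1/2, through the quadratic minorant
   (y - 1/2)/3 - y^2/36 of the indicator function of [1/2, +oo[. *)
Lemma rademacher_small_ball a :
  (1 / 12) * #|{ffun I -> bool}|%:R <=
  \sum_(s : {ffun I -> bool}) (((\sum_k a k ^+ 2) / 2 <=
     (\sum_k (-1) ^+ s k * a k) ^+ 2)%R)%:R :> R.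
Proof.
set m := \sum_k a k ^+ 2; set K : R := #|_|%:R.
have m0 : 0 <= m by apply: sumr_ge0 => k _; exact: sqr_ge0.
have K0 : 0 <= K by rewrite ler0n.
have [mp|] := ltP 0 m; last first.
  move=> m0'; have {m0'}mE : m = 0 by lra.
  rewrite (eq_bigr (fun=> 1)) ?sumr_const -/K; first by lra.
  by move=> s _; rewrite mE mul0r sqr_ge0.
pose y (s : {ffun I -> bool}) := sgn_sum a (index_enum I) s ^+ 2 / m.
(* Under uniform signs [y] has mean 1 and second moment at most 3, so the minorant averages at least
   (1 - 1/2)/3 - 3/36 = 1/12. *)
apply: (@le_trans _ _ (\sum_s ((y s - 1/2) / 3 - y s ^+ 2 / 36))).
  rewrite big_split/= sumrN -!mulr_suml big_split/= sumr_const.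
  rewrite -[_ *+ #|_|]mulr_natl -/K.
  rewrite -mulr_suml sum_sgn_sum2 ?index_enum_uniq// -/K -/m.
  have -> : \sum_s y s ^+ 2 = (\sum_s sgn_sum a (index_enum I) s ^+ 4) / m ^+ 2.
    by rewrite mulr_suml; apply: eq_bigr => s _; rewrite expr_div_n -exprM.
  rewrite mulfK ?gt_eqF//.
  have : (\sum_s sgn_sum a (index_enum I) s ^+ 4) / m ^+ 2 <= 3 * K.
    by rewrite ler_pdivrMr ?exprn_gt0//;
      exact: sum_sgn_sum4 (index_enum_uniq _).
  lra.
apply: ler_sum => s _; have -> :
  (m / 2 <= (\sum_k (-1) ^+ s k * a k) ^+ 2) = (1 / 2 <= y s).
  by rewrite /y ler_pdivlMr// mulrC; congr (_ <= _); lra.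
(* One minus the minorant is ((y - 6)^2 + 6)/36, hence positive; for y < 1/2 the minorant itself is
   negative. *)
have h1 : 0 <= (y s - 6) ^+ 2 by exact: sqr_ge0.
have h2 : 0 <= y s ^+ 2 by exact: sqr_ge0.
by case: (leP (1 / 2) (y s)) => /= h; [rewrite mulr1n|rewrite mulr0n];
  move: h1 h2 h; move: (y s) => z; nra.
Qed.

End rademacher.

(** * The heavy-tailed radius *)

Section geometric.
Context {R : realType}.

Lemma nneseries_geometric (c z : R) : 0 <= z < 1 ->
  (\sum_(0 <= k <oo) (c * z ^+ k)%:E = (c / (1 - z))%:E)%E.
Proof.
move=> /andP[z0 z1]; under eq_fun do rewrite sumEFin.
have h : series (geometric c z) n @[n --> \oo] --> c / (1 - z).
  by apply: cvg_geometric_series; rewrite ger0_norm.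
by rewrite EFin_lim; [congr EFin; exact: (cvg_lim _ h)|apply/cvg_ex;
  exists (c / (1 - z))].
Qed.

Lemma nneseries_geometric_pinfty (c z : R) : 0 < c -> 1 <= z ->
  (\sum_(0 <= k <oo) (c * z ^+ k)%:E = +oo)%E.
Proof.
move=> c0 z1; apply/eqyP => A A0.
have ge0 k : (0 <= k)%N -> true -> (0 <= (c * z ^+ k)%:E)%E.
  by move=> _ _; rewrite lee_fin mulr_ge0 ?exprn_ge0// ltW// (lt_le_trans
    ltr01).
pose m := (Num.trunc (A / c)).+1.
apply: le_trans (nneseries_lim_ge m ge0).
rewrite sumEFin lee_fin.
apply: (@le_trans _ _ (\sum_(0 <= k < m) c)).
  rewrite sumr_const_nat subn0 -mulr_natr mulrC -ler_pdivrMr//.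
  by rewrite ltW// truncnS_gt.
by apply: ler_sum => k _; rewrite ler_peMr ?(ltW c0)// exprn_ege1.
Qed.

(** The weights are 8^-k - 8^-(k+1). Against a radius that doubles with [k], the ratio 1/8 gives
    tail exponent 3: first and second moments converge, the fourth diverges. *)
Definition radius_weight (k : nat) : {nonneg R} := (7 / 8 * (1 / 8) ^+ k)%:nng.

Lemma nneseries_radius_weight m :
  (\sum_(m <= k <oo) (radius_weight k)%:num%:E = ((1 / 8) ^+ m)%:E :> \bar R)%E.
Proof.
rewrite -nneseries_addn; last by move=> k; rewrite lee_fin.
under eq_eseriesr do rewrite /= addnC exprD mulrA.
rewrite nneseries_geometric; last lra.
by congr EFin; field.
Qed.

End geometric.

(** * Law of a fixed vector scaled by the random radius *)

Section radial.
Context {R : realType} {p : nat}.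
Implicit Types (v : 'rV[R]_p) (A : set 'rV[R]_p).

(* The law of [2 ^ K v], where [P (K = k) = 8 ^ - k - 8 ^ - (k + 1)], so that
   [P (K >= k) = 8 ^ - k]. *)
Definition radial v : set 'rV[R]_p -> \bar R :=
  mseries (fun k => mscale (radius_weight k) \d_(2 ^+ k *: v)) 0.

HB.instance Definition _ v := Measure.on (radial v).

Lemma radialE v A : (radial v A =
  \sum_(0 <= k <oo) (radius_weight k)%:num%:E * \d_(2 ^+ k *: v) A)%E.
Proof. by []. Qed.

Lemma radial1 v A : (forall k, A (2 ^+ k *: v)) -> radial v A = 1%E.
Proof.
move=> Av; rewrite radialE.
under eq_eseriesr do rewrite diracE mem_set// mule1.
by rewrite nneseries_radius_weight expr0.
Qed.

Lemma radial0 v A : (forall k, ~ A (2 ^+ k *: v)) -> radial v A = 0%E.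
Proof.
move=> Av; rewrite radialE eseries0// => k _ _.
by rewrite diracE memNset// mule0.
Qed.

Lemma radial_from v A m : (forall k, A (2 ^+ k *: v) <-> (m <= k)%N) ->
  radial v A = ((1 / 8) ^+ m)%:E.
Proof.
move=> Av; rewrite radialE (nneseries_split 0 m)/=; last first.
  by move=> k _; rewrite mule_ge0// lee_fin.
rewrite add0n big_nat big1 ?add0e; last first.
  move=> k /andP[_ km]; rewrite diracE memNset ?mule0// => /Av.
  by rewrite leqNgt km.
rewrite -nneseries_radius_weight -(nneseries_addn m)/=; last first.
  by move=> k; rewrite mule_ge0// lee_fin.
rewrite -[RHS](nneseries_addn m)/=; last by move=> k; rewrite lee_fin.
apply: eq_eseriesr => k _; rewrite diracE mem_set ?mule1//.
by apply/Av; rewrite leq_addl.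
Qed.

Lemma ge0_integral_radial v (f : 'rV[R]_p -> \bar R) :
  measurable_fun [set: 'rV[R]_p] f -> (forall x, 0 <= f x)%E ->
  (\int[radial v]_x f x =
   \sum_(0 <= k <oo) (radius_weight k)%:num%:E * f (2 ^+ k *: v)%R)%E.
Proof.
move=> mf f0; rewrite /radial ge0_integral_measure_series//.
apply: eq_eseriesr => k _; rewrite ge0_integral_mscale//.
by rewrite integral_dirac// diracT mul1e.
Qed.

End radial.

(** * The law of the random vector *)

Section sign_law.
Context {R : realType} {p : nat}.
Notation signs := {ffun 'I_p -> bool}.
Implicit Types (a : 'I_p -> R) (s : signs).

Definition sgn_row a s : 'rV[R]_p := \row_k ((-1) ^+ s k * a k).

Lemma sgn_rowE a s j k : (2 ^+ j *: sgn_row a s) ord0 k =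
  2 ^+ j * ((-1) ^+ s k * a k).
Proof. by rewrite !mxE. Qed.

Definition no_sign : signs := [ffun=> false].

Lemma card_signs_gt0 : (0 < #|signs|)%N.
Proof. by apply/card_gt0P; exists no_sign. Qed.

Definition sign_prob : {nonneg R} := (#|signs|%:R^-1)%:nng.

(* The law of [2 ^ K (e_1 a_1, ..., e_p a_p)], where the signs [e_i] are
   uniform and independent of [K]. *)
Definition sign_law a : set 'rV[R]_p -> \bar R :=
  msum (fun i => mscale sign_prob
    (radial (sgn_row a (nth no_sign (enum signs) i)))) #|signs|.

HB.instance Definition _ a := Measure.on (sign_law a).

(** [msum] takes measures indexed by naturals, hence the enumeration inside [sign_law]; this returns
    to a sum over sign patterns. *)
Lemma sum_nth_signs (F : signs -> \bar R) :
  (\sum_(i < #|signs|) F (nth no_sign (enum signs) i) = \sum_s F s)%E.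
Proof.
transitivity (\sum_(s <- enum signs) F s)%E; last by rewrite big_enum.
by rewrite (big_nth no_sign) -cardE big_mkord.
Qed.

Lemma sign_lawE a A :
  (sign_law a A = \sum_s sign_prob%:num%:E * radial (sgn_row a s) A)%E.
Proof. by rewrite -sum_nth_signs. Qed.

Lemma sum_sign_prob (c : R) :
  (\sum_(s : signs) sign_prob%:num%:E * c%:E = c%:E)%E.
Proof.
rewrite sumEFin sumr_const -mulr_natl mulrA /= mulfV ?mul1r//.
by rewrite pnatr_eq0 -lt0n card_signs_gt0.
Qed.

Lemma sign_law_setT a : sign_law a setT = 1%E.
Proof.
rewrite sign_lawE (eq_bigr (fun=> sign_prob%:num%:E * 1%:E)%E) ?sum_sign_prob//.
by move=> s _; rewrite radial1.
Qed.

HB.instance Definition _ a :=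
  Measure_isProbability.Build _ _ _ (sign_law a) (sign_law_setT a).

Lemma ge0_integral_sign_law a (f : 'rV[R]_p -> \bar R) :
  measurable_fun [set: 'rV[R]_p] f -> (forall x, 0 <= f x)%E ->
  (\int[sign_law a]_x f x = \sum_s sign_prob%:num%:E *
    \sum_(0 <= k <oo) (radius_weight k)%:num%:E * f (2 ^+ k *: sgn_row a
      s)%R)%E.
Proof.
move=> mf f0; rewrite /sign_law ge0_integral_measure_sum//.
rewrite -sum_nth_signs; apply: eq_bigr => i _.
by rewrite ge0_integral_mscale// ge0_integral_radial.
Qed.

(** Each sign pattern contributes the same geometric series of ratio z/8. Absolute first moments are
    the case z = 2, second moments the case z = 4. *)
Lemma ge0_integral_sign_law_geometric a (f : 'rV[R]_p -> R) (c z : R) :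
  measurable_fun [set: 'rV[R]_p] f -> (forall x, 0 <= f x) -> 0 <= z < 8 ->
  (forall k s, f (2 ^+ k *: sgn_row a s) = c * z ^+ k) ->
  (\int[sign_law a]_x (f x)%:E = (7 * c / (8 - z))%:E)%E.
Proof.
move=> mf f0 z8 fE; rewrite ge0_integral_sign_law//; last first.
  exact/measurable_EFinP.
rewrite -[RHS]sum_sign_prob; apply: eq_bigr => s _; congr (_ * _)%E.
under eq_eseriesr do rewrite fE -EFinM /= mulrACA -exprMn.
by rewrite nneseries_geometric; [congr EFin; field|]; lra.
Qed.

(** The sample space is R^p itself with probability [sign_law a], so the identity has exactly that
    law. *)
Definition sign_vec a : 'rV[R]_p -> 'rV[R]_p := id.
HB.instance Definition _ a := isMeasurableFun.Build _ _ _ _ (sign_vec a)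
  (@measurable_id _ _ setT).
Let Z a : {RV (sign_law a) >-> 'rV[R]_p} := sign_vec a.

Lemma sign_law_integrable_coord a k :
  (sign_law a).-integrable setT (EFin \o (fun w => w ord0 k)).
Proof.
apply/integrableP; split.
  by apply/measurable_EFinP; exact: measurable_coord.
rewrite (@ge0_integral_sign_law_geometric _ (fun w => `|w ord0 k|) `|a k| 2)//.
- exact: ltry.
- by apply: measurableT_comp => //; exact: measurable_coord.
- by lra.
- move=> j s; rewrite sgn_rowE !normrM normr_sign mul1r mulrC.
  by rewrite [ `|2 ^+ j|]ger0_norm ?exprn_ge0.
Qed.

Lemma sign_law_integrable_coordM a k l :
  (sign_law a).-integrable setT (EFin \o (fun w => w ord0 k * w ord0 l)).
Proof.
have mkl : measurable_fun [set: 'rV[R]_p]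
    (fun w : 'rV[R]_p => w ord0 k * w ord0 l).
  by apply: measurable_funM; exact: measurable_coord.
apply/integrableP; split; first exact/measurable_EFinP.
rewrite (@ge0_integral_sign_law_geometric _ (fun w => `|w ord0 k * w ord0 l|)
  `|a k * a l| 4)//.
- exact: ltry.
- by apply: measurableT_comp.
- by lra.
- move=> j s; rewrite !sgn_rowE mulrACA [X in _ * X]mulrACA -exprMn.
  rewrite 2![in LHS]normrM [X in _ * (X * _)]normrM !normr_sign !mul1r.
  by rewrite mulrC -natrM [ `|_ ^+ j|]ger0_norm ?exprn_ge0// normrM.
Qed.

(** Flipping the sign of coordinate [k] exchanges its positive and negative parts, so their
    integrals agree; integrability makes the common value finite and the difference 0. *)
Lemma centered_sign_vec a : centered (Z a).
Proof.
move=> k; split; first exact: sign_law_integrable_coord.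
rewrite unlock integralE -[X in (X - _)%E]/(\int[_]_x _)%E.
set P := (X in (X - _)%E); set N := (X in (_ - X)%E).
have mc := @measurable_coord R p k.
suff PN : P = N.
  rewrite PN subee//; have /integrableP[_] := sign_law_integrable_coord a k.
  rewrite ge0_fin_numE ?integral_ge0//; apply: le_lt_trans.
  apply: ge0_le_integral => //.
  - by apply: measurable_funeneg; exact/measurable_EFinP.
  - by apply: measurableT_comp => //; exact/measurable_EFinP.
  - by move=> x _; rewrite funenegE ge_max abse_ge0 andbT /= lee_fin -normrN
      ler_norm.
rewrite /P /N !ge0_integral_sign_law//; last 2 first.
- by apply: measurable_funeneg; exact/measurable_EFinP.
- by apply: measurable_funepos; exact/measurable_EFinP.
rewrite (reindex_inj (inv_inj (flipK k))); apply: eq_bigr => s _;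
  congr (_ * _)%E.
apply: eq_eseriesr => j _; congr (_ * _)%E.
by rewrite funeposE funenegE /= /Z /sign_vec sgn_rowE sgn_flip mulNr mulrN
  -sgn_rowE EFinN.
Qed.

Lemma finite_covariance_sign_vec a : finite_covariance (Z a).
Proof.
split=> [k|k l]; [exact: sign_law_integrable_coord|exact:
  sign_law_integrable_coordM].
Qed.

(** A doubled radius multiplies the fourth power by 16 and the weight by 1/8: the series has ratio 2
    and diverges for every sign pattern. *)
Lemma infinite_fourth_moments_sign_vec a : (forall k, a k != 0) ->
  infinite_fourth_moments (Z a).
Proof.
move=> a0 k; rewrite unlock ge0_integral_sign_law//; last 2 first.
- by apply/measurable_EFinP/measurable_funX; exact: measurable_coord.
- by move=> x; rewrite lee_fin exprn_even_ge0.
have E s : (\sum_(0 <= j <oo) (radius_weight j)%:num%:E *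
    (Z a (2 ^+ j *: sgn_row a s) ord0 k ^+ 4)%:E = +oo :> \bar R)%E.
  rewrite -(@nneseries_geometric_pinfty _ (7 / 8 * a k ^+ 4) 2)//; last 2 first.
  - by rewrite mulr_gt0 ?divr_gt0// exprn_even_gt0//= a0.
  - by lra.
  apply: eq_eseriesr => j _; rewrite -EFinM /Z /sign_vec sgn_rowE;
    congr EFin => /=.
  have -> : (2 ^+ j * ((-1) ^+ s k * a k)) ^+ 4 = a k ^+ 4 * 16 ^+ j.
    rewrite exprMn exprAC mulrC; congr (_ * _); last by congr (_ ^+ j); ring.
    by case: (s k); rewrite ?expr0 ?expr1; ring.
  by rewrite mulrACA -exprMn; congr (_ * _ ^+ j); field.
rewrite (bigD1 no_sign)//= E gt0_muley ?addye//.
- rewrite gt_eqF// (lt_le_trans ltNy0)// sume_ge0// => s _.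
  by rewrite E mule_ge0// lee_fin.
- by rewrite lte_fin invr_gt0 ltr0n card_signs_gt0.
Qed.

(** The modulus of coordinate [k] is 2^K a_k whatever the signs. If [m] is least with t <= 2^m a_k,
    the tail probability is 8^-m = a_k^3 / (2^m a_k)^3, which is comparable to (a_k / t)^3 because
    2^m a_k lies between t and 2t. *)
Lemma polynomial_tails_sign_vec a : (forall k, 0 < a k) ->
  polynomial_tails (Z a).
Proof.
move=> a0 k; exists (a k ^+ 3 / 8), (a k ^+ 3), 3, (a k).
have a30 : 0 < a k ^+ 3 by rewrite exprn_gt0.
split=> //; [by rewrite divr_gt0|by rewrite ler_pdivrMr// ler_peMr// ?ltW//;
  lra|].
move=> t at_; have t0 : 0 < t by apply: lt_le_trans at_.
have /ex_minnP[m tm mmin] : exists m, t <= 2 ^+ m * a k.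
  exists (Num.trunc (t / a k)).+1; rewrite -ler_pdivrMr//.
  apply: le_trans (ltW (truncnS_gt _)) _.
  by rewrite -natrX ler_nat ltnW// ltn_expl.
(* For positive [m] this is minimality; for m = 0 it rests on the threshold t0 = a_k. *)
have m2 : 2 ^+ m * a k <= 2 * t.
  case: m tm mmin => [_ _|m _ mmin]; first by rewrite expr0; lra.
  rewrite exprS -mulrA ler_pM2l// leNgt; apply/negP => /ltW /mmin.
  by rewrite ltnn.
have PE : sign_law a [set w | t <= `|Z a w ord0 k|] = ((1 / 8) ^+ m)%:E.
  rewrite sign_lawE -[RHS]sum_sign_prob; apply: eq_bigr => s _; congr (_ * _)%E.
  apply: radial_from => j /=; rewrite /Z /sign_vec sgn_rowE 2!normrM normr_sign
    mul1r.
  rewrite ger0_norm ?exprn_ge0// gtr0_norm//; split=> [/mmin//|mj].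
  apply: le_trans tm _; rewrite ler_pM2r//.
  by rewrite ler_weXn2l//; lra.
suff : ((a k ^+ 3 / 8 * t `^ (- 3))%:E <= ((1 / 8) ^+ m)%:E <=
    (a k ^+ 3 * t `^ (- 3))%:E)%E by rewrite -PE => /andP[].
rewrite !lee_fin powRN powR_mulrn ?(ltW t0)//.
have -> : (1 / 8 : R) ^+ m = a k ^+ 3 / (2 ^+ m * a k) ^+ 3.
  rewrite [(_ * a k) ^+ 3]exprMn invfM mulrCA divff ?gt_eqF// mulr1 div1r
    exprVn exprAC.
  by congr (_ ^+ m)^-1; ring.
have tX : 0 < t ^+ 3 by rewrite exprn_gt0.
have mX : 0 < 2 ^+ m * a k by rewrite mulr_gt0// exprn_gt0.
apply/andP; split; last first.
  by rewrite ler_pM2l// lef_pV2 ?posrE ?exprn_gt0// lerXn2r ?nnegrE// ltW.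
rewrite -mulrA ler_pM2l// -invfM lef_pV2 ?posrE ?exprn_gt0 ?mulr_gt0//.
have -> : 8 * t ^+ 3 = (2 * t) ^+ 3 by ring.
by rewrite lerXn2r ?nnegrE// ltW// mulr_gt0.
Qed.

(** Whether signs are good depends only on the Rademacher sum with coefficients a_k v_k. For good
    signs every radius 2^j >= 1 keeps the inequality, and a_k >= 1 makes the sum of squares at least
    ||v||^2. The level 1/2 for squares becomes 1/sqrt 2. *)
Lemma small_ball_sign_vec a : (forall k, 1 <= a k) ->
  small_ball (1 / Num.sqrt 2) (1 / 12) (Z a).
Proof.
move=> a1; apply/ereal_infP => _ [v _ <-]; set A := [set w | _].
pose b k := a k * v ord0 k.
pose good (s : signs) := (\sum_k b k ^+ 2) / 2 <=
  (\sum_k (-1) ^+ s k * b k) ^+ 2.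
have goodA s j : good s -> A (2 ^+ j *: sgn_row a s).
  move=> gs; rewrite /A /= /Z /sign_vec.
  have -> : dot (2 ^+ j *: sgn_row a s) v = 2 ^+ j * \sum_k (-1) ^+ s k * b k.
    rewrite /dot mulr_sumr; apply: eq_bigr => k _.
    by rewrite sgn_rowE /b !mulrA.
  rewrite normrM (@le_trans _ _ `|\sum_k (-1) ^+ s k * b k|)//; last first.
    by rewrite ler_peMl// ger0_norm ?exprn_ge0// exprn_ege1//; lra.
  rewrite div1r /l2norm -sqrtrV// -sqrtrM ?invr_ge0// -sqrtr_sqr ler_sqrt
    ?sqr_ge0//.
  apply: le_trans gs; rewrite mulrC ler_pM2r ?invr_gt0//.
  apply: ler_sum => k _; rewrite /b exprMn -expr2 ler_peMl ?sqr_ge0//.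
  by rewrite exprn_ege1.
suff : ((1 / 12)%:E <= sign_law a A)%E by [].
rewrite sign_lawE; apply: (@le_trans _ _
  (\sum_(s : signs) sign_prob%:num%:E * ((good s)%:R)%:E)%E).
  rewrite sumEFin lee_fin -mulr_sumr [leRHS]mulrC /= ler_pdivlMr ?ltr0n
    ?card_signs_gt0//.
  exact: rademacher_small_ball.
apply: lee_sum => s _; apply: lee_pmul => //; rewrite ?lee_fin//.
have [gs|_] := boolP (good s); last by rewrite measure_ge0.
by rewrite radial1// => j; exact: goodA.
Qed.

End sign_law.

(** * The infimum of a quadratic form over a polyhedral cone *)

Section euclidean_facts.
Context {R : realType}.

Lemma dot_ge0 p (u : 'rV[R]_p) : 0 <= dot u u.
Proof. by apply: sumr_ge0 => i _; rewrite -expr2 sqr_ge0. Qed.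

Lemma l2norm_sqr p (u : 'rV[R]_p) : l2norm u ^+ 2 = dot u u.
Proof. by rewrite sqr_sqrtr ?dot_ge0. Qed.

Lemma dotZ p (c : R) (u : 'rV[R]_p) : dot (c *: u) (c *: u) = c ^+ 2 * dot u u.
Proof. by rewrite /dot mulr_sumr; apply: eq_bigr => i _; rewrite !mxE;
  ring. Qed.

Lemma dot_eq0 p (u : 'rV[R]_p) : dot u u = 0 -> u = 0.
Proof.
move=> /eqP; rewrite psumr_eq0; last by move=> i _; rewrite -expr2 sqr_ge0.
move=> /allP u0; apply/rowP => i; rewrite mxE; apply/eqP.
by have := u0 i (mem_index_enum i); rewrite /= -expr2 sqrf_eq0.
Qed.

Lemma sphereP p (u : 'rV[R]_p) : sphere p u <-> dot u u = 1.
Proof.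
rewrite -l2norm_sqr /sphere/=; split=> [->|/eqP]; first by rewrite expr1n.
by rewrite sqrf_eq1 => /orP[/eqP//|/eqP u1]; have := sqrtr_ge0 (dot u u);
  rewrite -/(l2norm u) u1 lerNr oppr0 ler10.
Qed.

Definition conic_hull p m (V : 'I_m -> 'rV[R]_p) : set 'rV[R]_p :=
  [set x | exists2 a : 'I_m -> R,
    forall i, 0 <= a i & x = \sum_(i < m) a i *: V i].

Definition sqnorm_mul n p (X : 'M[R]_(n, p)) (u : 'rV[R]_p) : R :=
  dot (X *m u^T)^T (X *m u^T)^T.

Lemma sqnorm_mulE n p (X : 'M[R]_(n, p)) u :
  sqnorm_mul X u = \sum_i (\sum_k X i k * u ord0 k) ^+ 2.
Proof.
apply: eq_bigr => i _; rewrite !mxE -expr2; congr (_ ^+ 2).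
by apply: eq_bigr => k _; rewrite !mxE.
Qed.

Lemma sqnorm_mulZ n p (X : 'M[R]_(n, p)) c u :
  sqnorm_mul X (c *: u) = c ^+ 2 * sqnorm_mul X u.
Proof. by rewrite /sqnorm_mul linearZ /= -scalemxAr linearZ /= dotZ. Qed.

Lemma inf_sqnorm_ge0 n p (X : 'M[R]_(n, p)) A : (0 <= inf_sqnorm X A)%E.
Proof. by apply/ereal_infP => _ [u _ <-]; rewrite lee_fin sqr_ge0. Qed.

Lemma cvg_sumr (I : finType) (f : I -> nat -> R) (l : I -> R) :
  (forall i, f i k @[k --> \oo] --> l i) ->
  \sum_i f i k @[k --> \oo] --> \sum_i l i.
Proof. by move=> fl; apply: cvg_big => //; exact: add_continuous. Qed.

(** This approximates real cone coefficients by rationals with the common denominator k+1. *)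
Lemma cvg_truncn_div (a : R) : 0 <= a ->
  (Num.trunc (k.+1%:R * a))%:R / k.+1%:R @[k --> \oo] --> a.
Proof.
move=> a0; apply/cvgrPdist_le => e e0; near=> k.
have k0 : 0 < k.+1%:R :> R by rewrite ltr0n.
have /andP[lo hi] := truncn_itv (mulr_ge0 (ltW k0) a0).
rewrite ger0_norm; last by rewrite subr_ge0 ler_pdivrMr// [leRHS]mulrC.
rewrite -(ler_pM2r k0) mulrBl divfK ?gt_eqF//.
apply: (@le_trans _ _ 1); first by rewrite lerBlDl [a * _]mulrC natr1 ltW.
rewrite -ler_pdivrMr// div1r ltW//.
by near: k; exact: (near_infty_natSinv_lt (PosNum e0)).
Unshelve. all: by end_near. Qed.

(* The form is homogeneous and the cone has finitely many generators, so that
   the strict inequality can be tested on integer combinations only; there are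
   countably many of them. *)
Lemma inf_sqnorm_lt n p m (V : 'I_m -> 'rV[R]_p) (X : 'M[R]_(n, p)) (c : R) :
  (inf_sqnorm X (conic_hull V `&` sphere p) < c%:E)%E <->
  exists b : {ffun 'I_m -> nat},
    let y := \sum_(i < m) (b i)%:R *: V i in sqnorm_mul X y < c * dot y y.
Proof.
split=> [/ereal_inf_ltP[_ [_ [[a a0 ->] /sphereP u1] <-]]|[b /= yc]].
  rewrite lte_fin l2norm_sqr; move: u1; set u := \sum_(i < m) _ => u1.
  rewrite -/(sqnorm_mul _ _) => uc.
  (* Rounding gives rational points [y k] converging to [u]. Both sides are continuous, so the
     strict inequality holds at some [y k], and homogeneity then clears the denominator k+1. *)
  pose b k := [ffun i => Num.trunc (k.+1%:R * a i)] : {ffun 'I_m -> nat}.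
  pose y k := \sum_(i < m) ((b k i)%:R / k.+1%:R) *: V i.
  have yu l : y k ord0 l @[k --> \oo] --> u ord0 l.
    rewrite summxE; under eq_cvg do rewrite summxE.
    apply: cvg_sumr => i; rewrite mxE; under eq_cvg do rewrite mxE.
    apply: cvgM; last exact: cvg_cst.
    by under eq_cvg do rewrite ffunE; exact: cvg_truncn_div.
  have cy : c * dot (y k) (y k) - sqnorm_mul X (y k) @[k --> \oo] -->
      c * dot u u - sqnorm_mul X u.
    apply: cvgB.
      by apply: cvgM; [exact: cvg_cst|apply: cvg_sumr => l; exact: cvgM].
    rewrite sqnorm_mulE; under eq_cvg do rewrite sqnorm_mulE.
    apply: cvg_sumr => i; under eq_cvg do rewrite expr2.
    have Xy : \sum_l X i l * y k ord0 l @[k --> \oo] --> \sum_l X i l * u ord0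
      l.
      by apply: cvg_sumr => l; apply: cvgM => //; exact: cvg_cst.
    by rewrite expr2; exact: cvgM.
  have [k] : exists k, 0 < c * dot (y k) (y k) - sqnorm_mul X (y k).
    have /cvgr_gt /(_ 0) := cy; rewrite u1 mulr1 subr_gt0 => /(_ uc).
    by case=> N _ /(_ N (leqnn N)); exists N.
  rewrite subr_gt0 => yk; exists (b k) => /=.
  have -> : \sum_(i < m) (b k i)%:R *: V i = k.+1%:R *: y k.
    rewrite scaler_sumr; apply: eq_bigr => i _.
    by rewrite scalerA mulrC divfK// pnatr_eq0.
  by rewrite sqnorm_mulZ dotZ mulrCA ltr_pM2l//.
(* At y = 0 both sides vanish, so the strict inequality forces y to be nonzero and it can be
   normalised onto the sphere. *)
set y := \sum_(i < m) _ in yc; have y0 : 0 < dot y y.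
  rewrite lt_neqAle dot_ge0 andbT eq_sym; apply/eqP => y0; move: yc.
  rewrite y0 mulr0 (dot_eq0 y0) /sqnorm_mul trmx0 mulmx0 trmx0.
  by rewrite /dot big1 ?ltxx// => i _; rewrite mxE mul0r.
apply/ereal_inf_ltP.
have t0 : 0 <= (l2norm y)^-1 by rewrite invr_ge0 sqrtr_ge0.
have t2 : (l2norm y)^-1 ^+ 2 = (dot y y)^-1 by rewrite exprVn l2norm_sqr.
exists (sqnorm_mul X ((l2norm y)^-1 *: y))%:E; last first.
  by rewrite lte_fin sqnorm_mulZ t2 mulrC ltr_pdivrMr.
exists ((l2norm y)^-1 *: y); last by rewrite l2norm_sqr.
split; last by apply/sphereP; rewrite dotZ t2 mulVf// gt_eqF.
exists (fun i => (l2norm y)^-1 * (b i)%:R); first by move=> i; rewrite mulr_ge0.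
by rewrite scaler_sumr; apply: eq_bigr => i _; rewrite scalerA.
Qed.

Lemma inf_sqnorm_eq0 n p m (V : 'I_m -> 'rV[R]_p) (X : 'M[R]_(n, p)) j :
  V j != 0 -> sqnorm_mul X (V j) = 0 ->
    inf_sqnorm X (conic_hull V `&` sphere p) = 0%E.
Proof.
move=> Vj XV; apply/eqP; rewrite eq_le inf_sqnorm_ge0 andbT.
apply/lee_addgt0Pr => e e0; rewrite add0e; apply/ltW/inf_sqnorm_lt.
exists [ffun i => (i == j) : nat] => /=.
rewrite (bigD1 j)//= big1 ?addr0; last first.
  by move=> i /negbTE ij; rewrite ffunE ij scale0r.
rewrite ffunE eqxx scale1r XV mulr_gt0// lt_neqAle dot_ge0 andbT eq_sym.
by apply: contra Vj => /eqP /dot_eq0 ->.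
Qed.

(** The infimum runs over an uncountable set, but testing integer combinations turns the event into
    a countable union of measurable ones. *)
Lemma measurable_inf_sqnorm_lt n p m (V : 'I_m -> 'rV[R]_p) (c : R)
    d (T : measurableType d) (P : probability T R)
    (X : 'I_n -> {RV P >-> 'rV[R]_p}) :
  measurable [set w | (inf_sqnorm (rows_mx X w) (conic_hull V `&` sphere p)
    < c%:E)%E].
Proof.
pose y (b : {ffun 'I_m -> nat}) := \sum_(i < m) (b i)%:R *: V i.
rewrite (_ : mkset _ = \bigcup_b
  [set w | sqnorm_mul (rows_mx X w) (y b) < c * dot (y b) (y b)]); last first.
  apply/seteqP; split=> w /= => [/inf_sqnorm_lt[b] yc|[b _] /= yc].
    by exists b.
  by apply/inf_sqnorm_lt; exists b.
apply: countable_bigcupT_measurable => [|b]; first exact: countableP.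
have mf : measurable_fun [set: T] (fun w => sqnorm_mul (rows_mx X w) (y b)).
  under eq_fun do rewrite sqnorm_mulE.
  apply: measurable_sum => i; apply: measurable_funX;
    apply: measurable_sum => k.
  apply: measurable_funM => //; under eq_fun do rewrite mxE.
  exact: (measurableT_comp (measurable_coord k) (measurable_funPT (X i))).
rewrite -[X in measurable X]setTI.
have := mf measurableT _ (measurable_itv `]-oo, (c * dot (y b) (y b))[).
by congr (measurable (_ `&` _)); apply/seteqP; split=> w; rewrite /= in_itv.
Qed.

Lemma measurable_inf_sqnorm_eq0 n p m (V : 'I_m -> 'rV[R]_p)
    d (T : measurableType d) (P : probability T R)
    (X : 'I_n -> {RV P >-> 'rV[R]_p}) :
  measurable [set w | inf_sqnorm (rows_mx X w) (conic_hull V `&` sphere p)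
    = 0%E].
Proof.
rewrite (_ : mkset _ = \bigcap_(k in [set: nat])
  [set w | (inf_sqnorm (rows_mx X w) (conic_hull V `&` sphere p)
    < k.+1%:R^-1%:E)%E]).
  by apply: bigcap_measurableType => k _; exact: measurable_inf_sqnorm_lt.
apply/seteqP; split=> w /= w0; first by move=> k _ /=;
  rewrite w0 lte_fin invr_gt0.
apply/eqP; rewrite eq_le inf_sqnorm_ge0 andbT; apply/lee_addgt0Pr => e e0.
rewrite add0e; have [k _ ke] := @near_infty_natSinv_lt R (PosNum e0).
by apply/ltW/(lt_trans (w0 k I)); rewrite lte_fin; exact: (ke k (leqnn k)).
Qed.

End euclidean_facts.

(** * Opposite sign columns *)

Section antipodal_columns.
Context {N : nat} {T : finType} (opp : T -> T).
Notation columns := {ffun 'I_N.+1 -> T}.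

Definition antipodal (t : columns) : bool :=
  [exists j : 'I_N, t (lift ord0 j) == opp (t ord0)].

(** Once the first column is chosen, each of the other [N] columns must avoid a single value. *)
Lemma card_not_antipodal :
  (#|[pred t : columns | ~~ antipodal t]| <= #|T| * #|T|.-1 ^ N)%N.
Proof.
pose F (c : T) (k : 'I_N.+1) : pred T :=
  if k == ord0 then pred1 c else predC1 (opp c).
have cardF c : #|family (F c)| = (#|T|.-1 ^ N)%N.
  rewrite card_family foldrE big_map big_enum/= big_ord_recl /F eqxx card1
    mul1n.
  under eq_bigr => i _ do rewrite cardC1.
  by rewrite prod_nat_const card_ord.
rewrite -[X in (X * _)%N]sum1_card big_distrl/=.
under eq_bigr => c _ do rewrite mul1n -(cardF c).
rewrite -[leqLHS]sum1_card
  (partition_big (fun t : columns => t ord0) xpredT)//=.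
apply: leq_sum => c _; rewrite sum1dep_card; apply: subset_leq_card.
apply/fintype.subsetP => t; rewrite !inE => /andP[nt /eqP tc].
apply/familyP => k; rewrite /F; case: (unliftP ord0 k) => [j ->|->].
  rewrite eq_sym (negbTE (neq_lift _ _)) !inE -tc.
  by apply: contra nt => tj; apply/existsP; exists j.
by rewrite eqxx inE tc.
Qed.

End antipodal_columns.

(** * Sign patterns of independent rows and the probability of opposite columns *)

Section rays.
Context {R : realType} {N : nat} (a : 'I_N.+1 -> R).
Hypothesis a0 : forall k, 0 < a k.
Notation signs := {ffun 'I_N.+1 -> bool}.

(** This is the open half-line spanned by [sgn_row a s], parametrised by the modulus of the first
    coordinate. Distinct patterns give disjoint rays, so the signs can be read off a value of the
    vector without access to the radius. *)
Definition ray (s : signs) : set 'rV[R]_N.+1 :=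
  [set z | 0 < `|z ord0 ord0| /\
    forall k, z ord0 k = `|z ord0 ord0| / a ord0 * ((-1) ^+ s k * a k)].

Lemma measurable_ray s : measurable (ray s).
Proof.
have mc := @measurable_coord R N.+1.
have mr (f : 'rV[R]_N.+1 -> R) (B : set R) :
  measurable_fun [set: 'rV[R]_N.+1] f ->
    measurable B -> measurable (f @^-1` B).
  by move=> mf mB; rewrite -[X in measurable X]setTI; exact: mf.
rewrite (_ : ray s = (fun z => `|z ord0 ord0|) @^-1` `]0, +oo[ `&`
  \bigcap_(k in [set: 'I_N.+1])
    (fun z => z ord0 k - `|z ord0 ord0| / a ord0 * ((-1) ^+ s k * a k)) @^-1`
      [set 0]).
  apply: measurableI.
    by apply: mr => //; exact: measurableT_comp.
  apply: fin_bigcap_measurable => // k _; apply: mr => //.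
  apply: measurable_funB => //; apply: measurable_funM => //.
  by apply: measurable_funM => //; exact: measurableT_comp.
apply/seteqP; split=> z /=; rewrite in_itv/= andbT => -[z0 zs]; split=> // k.
  by move=> _ /=; rewrite {1}zs subrr.
by apply/eqP; rewrite -subr_eq0; apply/eqP; exact: zs.
Qed.

Lemma ray_inj z s s' : ray s z -> ray s' z -> s = s'.
Proof.
move=> [z0 zs] [_ zs']; apply/ffunP => k.
have : (-1) ^+ s k = (-1) ^+ s' k :> R.
  have c0 : `|z ord0 ord0| / a ord0 != 0 by rewrite gt_eqF// divr_gt0.
  apply: (mulIf (lt0r_neq0 (a0 k))); apply: (mulfI c0).
  by rewrite -zs -zs'.
by case: (s k); case: (s' k) => //; rewrite ?expr0 ?expr1; lra.
Qed.

Lemma ray_sgn_row s j : ray s (2 ^+ j *: sgn_row a s).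
Proof.
have N0 : `|2 ^+ j * ((-1) ^+ s ord0 * a ord0)| = 2 ^+ j * a ord0.
  by rewrite 2!normrM normr_sign mul1r !gtr0_norm ?exprn_gt0.
split=> [|k]; rewrite !sgn_rowE N0 ?mulr_gt0 ?exprn_gt0//.
by rewrite mulfK// gt_eqF.
Qed.

Lemma sign_law_ray s : sign_law a (ray s) = (@sign_prob R N.+1)%:num%:E.
Proof.
rewrite sign_lawE (bigD1 s)//= radial1 ?mule1; last exact: ray_sgn_row.
rewrite big1 ?adde0// => s' ss'; rewrite radial0 ?mule0// => j rs.
by move/eqP: ss'; apply; exact: ray_inj (ray_sgn_row s' j) rs.
Qed.

Context {n : nat} {d : measure_display} {T : measurableType d}
  {P : probability T R} (X : 'I_n -> {RV P >-> 'rV[R]_N.+1}).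
Let Z : {RV (sign_law a) >-> 'rV[R]_N.+1} := sign_vec a.
Hypothesis copies : independent_copies Z X.

(** The pattern is stored by columns: [t k i] is the sign of coordinate [k] in row [i], so that
    opposite columns are values of [t]. *)
Definition sign_cell (t : {ffun 'I_N.+1 -> {ffun 'I_n -> bool}}) : set T :=
  [set w | forall i, ray [ffun k => t k i] (X i w)].

Lemma sign_cellE t : sign_cell t =
  \bigcap_(i in [set` [set: 'I_n]%SET]) (X i @^-1` ray [ffun k => t k i]).
Proof.
apply/seteqP; split=> w /= tw i //; first by move=> _; exact: tw.
by apply: tw; rewrite /= inE.
Qed.

Lemma measurable_sign_cell t : measurable (sign_cell t).
Proof.
rewrite sign_cellE; apply: fin_bigcap_measurable => // i _.
by rewrite -[X in measurable X]setTI; apply: measurable_funPT => //;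
  exact: measurable_ray.
Qed.

Lemma prob_sign_cell t :
  P (sign_cell t) = ((@sign_prob R N.+1)%:num ^+ n)%:E.
Proof.
case: copies => ind dist; rewrite sign_cellE ind; last by move=> i;
  exact: measurable_ray.
rewrite (eq_bigr (fun=> (@sign_prob R N.+1)%:num%:E)); last first.
  by move=> i _; rewrite -(sign_law_ray [ffun k => t k i]); apply: dist;
    exact: measurable_ray.
rewrite prodEFin; congr EFin; rewrite prodr_const; congr (_ ^+ _).
by rewrite cardsT card_ord.
Qed.

Lemma trivIset_sign_cell D : trivIset D sign_cell.
Proof.
move=> t t' _ _ [w [tw tw']]; apply/ffunP => k; apply/ffunP => i.
by have /ffunP/(_ k) := ray_inj (tw i) (tw' i); rewrite !ffunE.
Qed.

(** [S] contains the cells of all antipodal patterns. These are disjoint and equiprobable, so the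
    bound reduces to counting the patterns that are not antipodal. *)
Lemma prob_antipodal (S : set T) : measurable S ->
  (forall (t : {ffun 'I_N.+1 -> {ffun 'I_n -> bool}}) j w,
    t (lift ord0 j) = [ffun i => ~~ t ord0 i] -> sign_cell t w -> S w) ->
  ((1 - (1 - 2 ^- n) ^+ N)%:E <= P S)%E.
Proof.
move=> mS cS.
pose A := [pred t : {ffun 'I_N.+1 -> {ffun 'I_n -> bool}} |
  antipodal (fun c : {ffun 'I_n -> bool} => [ffun i => ~~ c i]) t].
pose G := [fset t in enum A]%fset.
have GE : perm_eq G (enum A).
  by apply: uniq_perm; rewrite ?enum_uniq ?fset_uniq// => t; rewrite !inE.
apply: (@le_trans _ _ (P (\big[setU/set0]_(t <- G) sign_cell t))); last first.
  rewrite -bigcup_fset; apply: le_measure; last 2 first.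
  - exact: mem_set.
  - move=> w [t /=].
    by rewrite !inE mem_enum => /existsP[j /eqP tj]; exact: cS tj.
  apply/mem_set/fin_bigcup_measurable => // t _; exact: measurable_sign_cell.
rewrite measure_fbigsetU//; last 2 first.
- by move=> t _; exact: measurable_sign_cell.
- exact: trivIset_sign_cell.
rewrite (perm_big _ GE) big_enum.
rewrite (eq_bigr (fun=> ((@sign_prob R N.+1)%:num ^+ n)%:E)); last first.
  by move=> t _; exact: prob_sign_cell.
rewrite sumEFin lee_fin sumr_const -[leRHS]mulr_natl /=.
have := card_not_antipodal (N := N)
  (fun c : {ffun 'I_n -> bool} => [ffun i => ~~ c i]).
set B := #|_| => Bn; have := cardC A;
  have -> : #|predC A| = B by apply: eq_card.
move: Bn; rewrite !card_ffun !card_bool !card_ord => Bn AB.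
(* [Q] counts the possible sign columns: there are Q^(N+1) patterns, each of probability Q^-(N+1),
   and at most Q (Q - 1)^N are not antipodal. *)
pose Q : R := (2 ^ n)%:R; have Q0 : 0 < Q by rewrite ltr0n expn_gt0.
have AQ : #|A|%:R = Q ^+ N.+1 - B%:R :> R.
  by rewrite /Q -natrX -AB natrD addrK.
have BQ : B%:R <= Q * (Q - 1) ^+ N.
  rewrite (_ : Q - 1 = (2 ^ n).-1%:R); last by rewrite -subn1 natrB ?expn_gt0.
  by rewrite /Q -natrX -natrM ler_nat.
have -> : (((2 ^ N.+1)%:R)^-1 : R) ^+ n = (Q ^+ N.+1)^-1.
  by rewrite exprVn /Q -!natrX -!expnM mulnC.
rewrite -natrX -/Q AQ -[leLHS](mulfK (expf_neq0 N.+1 (lt0r_neq0 Q0))).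
rewrite ler_pM2r ?invr_gt0 ?exprn_gt0// mulrBl mul1r lerB//.
rewrite (le_trans BQ)// exprS mulrCA -exprMn mulrBl mul1r mulVf// gt_eqF//.
Qed.

End rays.

(** * Gaussian width of a thin set *)

Section gaussian_moment.
Context {R : realType}.
Local Notation mu := (@lebesgue_measure R).

(** The Radon-Nikodym derivative and the explicit density have equal integrals over measurable sets,
    hence agree almost everywhere. *)
Lemma ge0_integral_normal_prob (m s : R) (f : measurableTypeR R -> \bar R) :
  measurable_fun setT f -> (forall x, 0 <= f x)%E ->
  (\int[normal_prob m s]_x f x = \int[mu]_x (f x * (normal_pdf m s x)%:E))%E.
Proof.
move=> mf f0; have dom := normal_prob_dominates m s.
rewrite -(Radon_Nikodym_SigmaFinite.change_of_variables dom)//.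
have mg := measurable_int _ (Radon_Nikodym_SigmaFinite.f_integrable dom).
have mp : measurable_fun [set: measurableTypeR R] (EFin \o normal_pdf m s).
  by apply/measurable_EFinP; exact: measurable_normal_pdf.
apply: ge0_ae_eq_integral => //.
- exact: emeasurable_funM.
- exact: emeasurable_funM.
- by move=> x _; rewrite mule_ge0// Radon_Nikodym_SigmaFinite.f_ge0.
- by move=> x _; rewrite mule_ge0// lee_fin normal_pdf_ge0.
apply: ae_eqe_mul2l; apply: integral_ae_eq => //.
  exact: Radon_Nikodym_SigmaFinite.f_integrable.
by move=> E _ mE; rewrite -Radon_Nikodym_SigmaFinite.f_integral.
Qed.

(* [|x| <= 1 + x^2/4 <= exp (x^2/4)], so that [|x|] times the density of N(0, 1)
   is at most [sqrt 2] times the density of N(0, 2). *)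
Lemma normal_prob_abs_moment :
  (\int[normal_prob (0 : R) 1]_x `|x|%:E <= (3 / 2)%:E)%E.
Proof.
rewrite ge0_integral_normal_prob//; last first.
  by apply/measurable_EFinP; exact: normr_measurable.
have s2 : Num.sqrt 2 != 0 :> R by rewrite gt_eqF// sqrtr_gt0.
(* The second parameter is a standard deviation, so this is the density of variance 2; its total
   mass 1 turns the bound into a comparison of integrands. *)
have -> : ((3 / 2)%:E = \int[mu]_x ((3 / 2)%:E *
    (normal_pdf (0 : R) (Num.sqrt 2) x)%:E))%E.
  by rewrite integralZl//= ?integral_normal_pdf ?mule1//;
    exact: integrable_normal_pdf.
apply: ge0_le_integral => //.
- by move=> x _; rewrite mule_ge0// lee_fin normal_pdf_ge0.
- apply: emeasurable_funM; apply/measurable_EFinP;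
    first exact: normr_measurable.
  exact: measurable_normal_pdf.
- apply: emeasurable_funM => //; apply/measurable_EFinP.
  exact: measurable_normal_pdf.
move=> x _; rewrite -!EFinM lee_fin !normal_pdfE ?oner_neq0// /normal_peak
  /normal_fun.
rewrite !subr0 expr1n mul1r sqr_sqrtr// -[pi *+ 2]mulr_natl.
rewrite -[(2 * pi) *+ 2]mulr_natl [Num.sqrt (2 * (2 * pi))]sqrtrM// invfM.
set c := (Num.sqrt (2 * pi))^-1.
have c0 : 0 <= c by rewrite invr_ge0 sqrtr_ge0.
have expE : expR (- x ^+ 2 / 2%:R) =
  expR (- (x ^+ 2 / 4)) * expR (- x ^+ 2 / (2 *+ 2)).
  by rewrite -expRD; congr expR; field.
rewrite expE.
have x1 : `|x| * expR (- (x ^+ 2 / 4)) <= 1.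
  rewrite expRN ler_pdivrMr ?expR_gt0// mul1r; apply: le_trans (expR_ge1Dx _).
  have : 0 <= (`|x| / 2 - 1) ^+ 2 by exact: sqr_ge0.
  by rewrite -(real_normK (num_real x)); lra.
(* Here the factor sqrt 2 is rounded up to 3/2. *)
have s232 : 1 <= 3 / 2 * (Num.sqrt 2)^-1 :> R.
  rewrite ler_pdivlMr ?sqrtr_gt0// mul1r -[leRHS]ger0_norm// -sqrtr_sqr.
  by rewrite ler_sqrt//; lra.
set q := expR (- x ^+ 2 / _); have q0 : 0 <= q by exact: expR_ge0.
rewrite [leLHS](_ : _ = (`|x| * expR (- (x ^+ 2 / 4))) * (c * q)); last by ring.
rewrite [leRHS](_ : _ = (3 / 2 * (Num.sqrt 2)^-1) * (c * q)); last by ring.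
by rewrite ler_wpM2r ?mulr_ge0// (le_trans x1).
Qed.

Lemma std_gaussian_coord n (k : 'I_n) (f : measurableTypeR R -> \bar R) :
  measurable_fun setT f -> (forall x, 0 <= f x)%E ->
  (\int[std_gaussian n]_g f (g ord0 k) = \int[normal_prob 0 1]_x f x)%E.
Proof.
move=> mf f0; have mk : measurable_fun [set: 'rV[R]_n]
    ((fun v => v ord0 k) : 'rV[R]_n -> measurableTypeR R).
  exact: measurable_coord.
rewrite -(ge0_integral_pushforward mk _ measurableT)//.
pose c : {mfun 'rV[R]_n >-> measurableTypeR R} := HB.pack_for
  {mfun 'rV[R]_n >-> measurableTypeR R} (fun v : 'rV[R]_n => v ord0 k)
  (isMeasurableFun.Build _ _ _ _ _ mk).
apply: (eq_measure_integral (normal_prob 0 1) (m1 := pushforward (std_gaussian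
  n) c)).
move=> A mA _.
(* The marginal law comes from a rectangle whose other sides are all of R. *)
pose B i : set R := if i == k then A else setT.
transitivity (std_gaussian n [set v | forall i, B i (v ord0 i)]).
  congr (std_gaussian n _); apply/seteqP; split=> v /= => [Av i|/(_ k)].
    by rewrite /B; case: eqVneq => [->|].
  by rewrite /B eqxx.
rewrite std_gaussian_rect; last by move=> i; rewrite /B; case: ifP.
rewrite (bigD1 k)//= /B eqxx big1 ?mule1// => i /negbTE ->.
exact: probability_setT.
Qed.

Lemma std_gaussian_abs_moment n (k : 'I_n) :
  (\int[@std_gaussian R n]_g `|g ord0 k|%:E <= (3 / 2)%:E)%E.
Proof.
rewrite (@std_gaussian_coord n k (fun x => `|x|%:E))//.
  exact: normal_prob_abs_moment.
by apply/measurable_EFinP; exact: normr_measurable.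
Qed.

End gaussian_moment.

Section width.
Context {R : realType}.

(* The integral of a nonnegative function is a supremum over the simple
   functions below it, so that monotonicity does not involve measurability. *)
Lemma integral_abs_bound d (T : measurableType d)
    (mu : {measure set T -> \bar R}) (F B : T -> \bar R) :
  (forall x, 0 <= B x)%E -> (forall x, - B x <= F x <= B x)%E ->
  (- (\int[mu]_x B x) <= \int[mu]_x F x <= \int[mu]_x B x)%E.
Proof.
move=> B0 FB.
have le_B (G : T -> \bar R) : (forall x, 0 <= G x)%E ->
    (forall x, G x <= B x)%E -> (\int[mu]_x G x <= \int[mu]_x B x)%E.
  move=> G0 GB; rewrite !ge0_integralTE//; apply: ereal_sup_le.
  by move=> _ [h hG <-]; exists h => // x; exact: le_trans (hG x) (GB x).
have Fp : (\int[mu]_x F^\+ x <= \int[mu]_x B x)%E.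
  by apply: le_B => // x; rewrite funeposE ge_max B0 andbT; case/andP : (FB x).
have Fn : (\int[mu]_x F^\- x <= \int[mu]_x B x)%E.
  apply: le_B => // x; rewrite funenegE ge_max B0 andbT leeNl.
  by case/andP : (FB x).
rewrite [X in (_ <= X <= _)%E]integralE; apply/andP; split.
  by rewrite -[leLHS]add0e leeB// integral_ge0.
by rewrite -[leRHS]sube0 leeB// integral_ge0.
Qed.

(** On [A] coordinate 0 is at most 1 in modulus and the others at most 1/M, so the supremum lies
    between [- b g] and [b g]; nonemptiness gives the lower half. A two-sided bound is wanted
    because the width is squared in [width_bound]. *)
Lemma gaussian_width_bound N (M : R) (A : set 'rV[R]_N.+1) : 0 < M ->
  A !=set0 -> A `<=` sphere N.+1 ->
  (forall u j, A u -> `|u ord0 (lift ord0 j)| <= `|u ord0 ord0| / M) ->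
  exists2 r : R, gaussian_width A = r%:E & `|r| <= 3 / 2 * (1 + N%:R / M).
Proof.
move=> M0 [u0 Au0] As Au.
pose b (g : 'rV[R]_N.+1) : R :=
  `|g ord0 ord0| + M^-1 * \sum_(j < N) `|g ord0 (lift ord0 j)|.
have b0 g : 0 <= b g.
  by rewrite addr_ge0// mulr_ge0 ?invr_ge0 ?(ltW M0)// sumr_ge0.
have dotb g u : A u -> `|dot g u| <= b g.
  move=> Auu; have u1 : `|u ord0 ord0| <= 1.
    have /sphereP uu := As _ Auu.
    rewrite -(@ler_pXn2r _ 2)// ?nnegrE// expr1n -normrX ger0_norm ?sqr_ge0//.
    by rewrite -uu /dot (bigD1 ord0)//= -expr2 lerDl sumr_ge0// => k _;
      rewrite -expr2 sqr_ge0.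
  apply: le_trans (ler_norm_sum _ _ _) _; rewrite big_ord_recl normrM lerD//.
    by rewrite ler_piMr.
  rewrite mulr_sumr; apply: ler_sum => j _; rewrite normrM mulrC ler_wpM2r//.
  apply: le_trans (Au _ _ Auu) _; rewrite -[leRHS]mul1r ler_pM2r ?invr_gt0//.
have intb : (\int[std_gaussian N.+1]_g (b g)%:E <=
  (3 / 2 * (1 + N%:R / M))%:E)%E.
  have mc (k : 'I_N.+1) : measurable_fun [set: 'rV[R]_N.+1] (fun g => `|g ord0
    k|%:E).
    by apply/measurable_EFinP/measurableT_comp => //; exact: measurable_coord.
  under eq_integral do rewrite EFinD EFinM -sumEFin.
  rewrite ge0_integralD//; last 2 first.
  - by move=> g _; rewrite mule_ge0// ?lee_fin ?invr_ge0 ?(ltW M0)// sume_ge0.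
  - apply: emeasurable_funM => //; apply: emeasurable_sum => j; exact: mc.
  rewrite ge0_integralZl//; last 3 first.
  - by apply: emeasurable_sum => j; exact: mc.
  - by move=> g _; rewrite sume_ge0.
  - by rewrite lee_fin invr_ge0 ltW.
  rewrite ge0_integral_sum//.
  rewrite (_ : 3 / 2 * (1 + N%:R / M) = 3 / 2 + M^-1 * \sum_(j < N) (3 / 2));
    last first.
    by rewrite sumr_const card_ord -[_ *+ N]mulr_natl; ring.
  rewrite EFinD [X in (_ <= _ + X)%E]EFinM -sumEFin; apply: leeD;
    first exact: std_gaussian_abs_moment.
  rewrite lee_wpmul2l ?lee_fin ?invr_ge0 ?(ltW M0)//.
  by apply: lee_sum => j _; exact: std_gaussian_abs_moment.
have : (- (\int[std_gaussian N.+1]_g (b g)%:E) <= gaussian_width A <=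
    \int[std_gaussian N.+1]_g (b g)%:E)%E.
  apply: integral_abs_bound => [g|g]; first by rewrite lee_fin.
  apply/andP; split.
    apply: (@le_trans _ _ (dot g u0)%:E).
      by rewrite -EFinN lee_fin lerNl (le_trans _ (dotb g u0 Au0))// -normrN
        ler_norm.
    by apply: ereal_sup_ubound; exists u0.
  apply: ge_ereal_sup => _ [u uA <-]; rewrite lee_fin.
  by apply: le_trans (dotb g u uA); exact: ler_norm.
move=> /andP[lo hi]; set c := 3 / 2 * _ in intb *.
have {}lo : ((- c)%:E <= gaussian_width A)%E.
  by apply: le_trans lo; rewrite EFinN leeN2.
have {}hi := le_trans hi intb.
have fw : gaussian_width A \is a fin_num.
  rewrite fin_numE; apply/andP; split; apply/eqP => w.
    by move: lo; rewrite w leeNy_eq.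
  by move: hi; rewrite w leye_eq.
exists (fine (gaussian_width A)); first by rewrite fineK.
by rewrite ler_norml -!lee_fin fineK// lo hi.
Qed.

End width.

(** * Existence of independent copies *)

Section copies_exist.
Context {R : realType} {p : nat} {d : measure_display} {T : measurableType d}
  {P : probability T R} (Z : {RV P >-> 'rV[R]_p}).

(** Full sets in all coordinates but one yield the law of each copy; full sets outside [J] yield
    independence for [J]. *)
Lemma product_ruleP n d' (T' : measurableType d') (P' : probability T' R)
    (X : 'I_n -> {RV P' >-> 'rV[R]_p}) :
  (forall B : 'I_n -> set 'rV[R]_p, (forall i, measurable (B i)) ->
    P' [set w | forall i, B i (X i w)] = (\prod_i P (Z @^-1` B i))%E) ->
  independent_copies Z X.
Proof.
move=> XB.
have law i (B : set 'rV[R]_p) : measurable B ->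
    P' (X i @^-1` B) = P (Z @^-1` B).
  move=> mB; have := XB (fun k => if k == i then B else setT).
  rewrite (bigD1 i)//= eqxx big1 ?mule1; last first.
    by move=> k /negbTE ->; rewrite preimage_setT probability_setT.
  move=> <-; last by move=> k; case: ifP.
  congr (P' _); apply/seteqP; split=> w /= => [wB k|/(_ i)];
    last by rewrite eqxx.
  by case: eqVneq => [->|].
split=> // J B mB; have := XB (fun k => if k \in J then B k else setT).
rewrite (bigID (mem J))/= [X in (_ * X)%E]big1 ?mule1; last first.
  by move=> k /negbTE ->; rewrite preimage_setT probability_setT.
move=> PB; rewrite (_ : \bigcap_(i in _) _ =
    [set w | forall i, (if i \in J then B i else setT) (X i w)]).
  rewrite PB; last by move=> k; case: ifP.
  by apply: eq_bigr => i iJ; rewrite iJ law.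
apply/seteqP; split=> w /= wB i; first by case: ifPn => // iJ; exact: wB.
by move=> /= iJ; have := wB i; rewrite iJ.
Qed.

(** The refutation needs an actual random matrix to which the uniform assertion applies. Each step
    of the induction takes the product with one more copy of the original space. *)
Lemma independent_copies_exist n :
  exists (d' : measure_display) (T' : measurableType d') (P' : probability T' R)
    (X : 'I_n -> {RV P' >-> 'rV[R]_p}), independent_copies Z X.
Proof.
suff [d' [T' [P' [X XB]]]] : exists (d' : measure_display)
    (T' : measurableType d')
    (P' : probability T' R) (X : 'I_n -> {RV P' >-> 'rV[R]_p}),
  forall B : 'I_n -> set 'rV[R]_p, (forall i, measurable (B i)) ->
    P' [set w | forall i, B i (X i w)] = (\prod_i P (Z @^-1` B i))%E.
  by exists d', T', P', X; exact: product_ruleP.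
elim: n => [|n [d' [T' [P' [X XB]]]]].
  (* With no rows the event is the whole space and the product is empty, so any probability space
     serves. *)
  exists d, T, P, (fun=> Z) => B _; rewrite big_ord0 -[RHS](probability_setT P).
  by congr (P _); apply/seteqP; split=> // w _ [].
have mZ : measurable_fun [set: T * T'] (fun w => Z w.1).
  exact: (measurableT_comp (measurable_funPT Z) measurable_fst).
have mX j : measurable_fun [set: T * T'] (fun w => X j w.2).
  exact: (measurableT_comp (measurable_funPT (X j)) measurable_snd).
pose Y0 : {mfun (T * T')%type >-> 'rV[R]_p} := HB.pack_for
  {mfun (T * T')%type >-> 'rV[R]_p} (fun w : T * T' => Z w.1)
  (isMeasurableFun.Build _ _ _ _ _ mZ).
pose Y j : {mfun (T * T')%type >-> 'rV[R]_p} := HB.pack_for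
  {mfun (T * T')%type >-> 'rV[R]_p} (fun w : T * T' => X j w.2)
  (isMeasurableFun.Build _ _ _ _ _ (mX j)).
exists _, (T * T')%type, (P \x P')%E,
  (fun i => if unlift ord0 i is Some j then Y j else Y0) => B mB.
rewrite big_ord_recl -(XB (B \o lift ord0))//=.
set C := [set w | forall i, B (lift ord0 i) (X i w)].
have mC : measurable C.
  rewrite (_ : C = \bigcap_(i in [set: 'I_n]) (X i @^-1` B (lift ord0 i))).
    apply: fin_bigcap_measurable => // i _; rewrite -[X in measurable X]setTI.
    exact: measurable_funPT.
  by apply/seteqP; split=> v /=; [move=> h i _; exact: h|move=> h i; exact: h].
rewrite -product_measure1E//; last first.
  by rewrite -[X in measurable X]setTI; exact: measurable_funPT.
congr (_ _); apply/seteqP; split=> -[x v] /= h.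
  split=> [|i]; first by have := h ord0; rewrite unlift_none.
  by have := h (lift ord0 i); rewrite liftK.
move=> i; case: (unliftP ord0 i) => [j ->|->]; first exact: h.2.
exact: h.1.
Qed.

End copies_exist.

(** * The counterexample *)

Section thin_cone.
Context {R : realType} {N : nat} (M : R).
Hypothesis M1 : 1 <= M.

Let M0 : 0 < M. Proof. exact: lt_le_trans M1. Qed.

Definition magnitude (k : 'I_N.+1) : R := if k == ord0 then 1 else M.

Definition generator (j : 'I_N) : 'rV[R]_N.+1 :=
  \row_k (if unlift ord0 k is Some i then (i == j)%:R / M else 1).

Definition thin_cone : set 'rV[R]_N.+1 := conic_hull generator.

Lemma magnitude_ge1 k : 1 <= magnitude k.
Proof. by rewrite /magnitude; case: ifP. Qed.

Lemma magnitude_gt0 k : 0 < magnitude k.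
Proof. exact: lt_le_trans (magnitude_ge1 k). Qed.

Lemma generator0 j : generator j ord0 ord0 = 1.
Proof. by rewrite mxE unlift_none. Qed.

Lemma generator_lift j i : generator j ord0 (lift ord0 i) = (i == j)%:R / M.
Proof. by rewrite mxE liftK. Qed.

Lemma generator_neq0 j : generator j != 0.
Proof.
apply/eqP => /rowP /(_ ord0); rewrite generator0 mxE.
by apply/eqP; rewrite oner_eq0.
Qed.

(** For coefficients b >= 0, coordinate 0 is the sum of all b_i, while coordinate [lift ord0 j] is
    b_j / M. *)
Lemma thin_cone_coord u j : thin_cone u ->
  `|u ord0 (lift ord0 j)| <= `|u ord0 ord0| / M.
Proof.
move=> [b b0 ->]; rewrite !summxE.
have -> : \sum_(i < N) (b i *: generator i) ord0 (lift ord0 j) = b j / M.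
  rewrite (bigD1 j)//= big1 ?addr0; last first.
    by move=> i ij; rewrite mxE generator_lift eq_sym (negbTE ij) mul0r mulr0.
  by rewrite mxE generator_lift eqxx mul1r.
have -> : \sum_(i < N) (b i *: generator i) ord0 ord0 = \sum_(i < N) b i.
  by apply: eq_bigr => i _; rewrite mxE generator0 mulr1.
rewrite !ger0_norm ?sumr_ge0 ?divr_ge0 ?(ltW M0)//.
by rewrite ler_pM2r ?invr_gt0// (bigD1 j)//= lerDl sumr_ge0.
Qed.

Lemma thin_cone_sphere_neq0 : (0 < N)%N ->
  (thin_cone `&` sphere N.+1) !=set0.
Proof.
move=> N0; pose v := generator (Ordinal N0).
have v0 : 0 < dot v v.
  rewrite lt_neqAle dot_ge0 andbT eq_sym; apply/eqP => /dot_eq0.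
  by apply/eqP; exact: generator_neq0.
exists ((l2norm v)^-1 *: v); split.
  exists (fun i => (l2norm v)^-1 * (i == Ordinal N0)%:R).
    by move=> i; rewrite mulr_ge0// invr_ge0 sqrtr_ge0.
  rewrite (bigD1 (Ordinal N0))//= big1 ?addr0 ?eqxx ?mulr1//.
  by move=> i /negbTE ->; rewrite mulr0 scale0r.
by apply/sphereP; rewrite dotZ exprVn l2norm_sqr mulVf// gt_eqF.
Qed.

(** In each row, the entry at [lift ord0 j] is -M times the first entry, and the weight 1/M in the
    generator makes the two contributions cancel. *)
Lemma antipodal_generator n (X : 'M[R]_(n, N.+1))
    (t : {ffun 'I_N.+1 -> {ffun 'I_n -> bool}}) j :
  t (lift ord0 j) = [ffun i => ~~ t ord0 i] ->
  (forall i, ray magnitude [ffun k => t k i] (row i X)) ->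
  sqnorm_mul X (generator j) = 0.
Proof.
move=> tj tX; rewrite sqnorm_mulE big1// => i _; apply/eqP; rewrite sqrf_eq0.
have [_ Xi] := tX i; have m0 : magnitude ord0 = 1 by rewrite /magnitude eqxx.
have {}Xi k : X i k = `|X i ord0| * ((-1) ^+ t k i * magnitude k).
  by have := Xi k; rewrite !mxE ffunE m0 divr1.
rewrite big_ord_recl generator0 mulr1 (bigD1 j)//= big1; last first.
  by move=> l lj; rewrite generator_lift (negbTE lj) mul0r mulr0.
rewrite generator_lift eqxx addr0 mul1r Xi (Xi (lift ord0 j)) tj ffunE.
rewrite m0 /magnitude (eq_sym (lift _ _)) (negbTE (neq_lift _ _)) mulr1.
rewrite [X in X / M]mulrA mulfK; last by rewrite gt_eqF.
by rewrite signrN mulrN subrr.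
Qed.

End thin_cone.

(** Raise 1 - x <= exp(-x) at x = 2^-n to the power 4^n, using 4^n 2^-n = 2^n. *)
Lemma one_minus_exp_le (R : realType) (n : nat) :
  (1 - 2 ^- n) ^+ (4 ^ n) <= expR (- 2 ^+ n) :> R.
Proof.
have p0 : 0 < 2 ^+ n :> R by rewrite exprn_gt0.
apply: (@le_trans _ _ (expR (- 2 ^- n) ^+ (4 ^ n))).
  rewrite lerXn2r ?nnegrE ?expR_ge0//.
    by rewrite subr_ge0 invf_le1// exprn_ege1// ler1n.
  exact: expR_ge1Dx.
rewrite -expRM_natl natrX ler_expR mulrN lerN2 -[4]/(2 * 2)%:R natrM.
by rewrite exprMn mulfK// gt_eqF.
Qed.

(** Measurability of the [width_bound] event is included because the refutation of the uniform
    assertion passes to its complement. *)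
Lemma counterexample (R : realType) (n : nat) : (1 <= n)%N ->
  exists C : set 'rV[R]_(4 ^ n).+1, polyhedral_cone C /\
  let A := C `&` sphere (4 ^ n).+1 in
  exists (d : measure_display) (T : measurableType d) (P : probability T R)
         (Z : {RV P >-> 'rV[R]_(4 ^ n).+1}),
  [/\ centered Z, finite_covariance Z, polynomial_tails Z,
      infinite_fourth_moments Z & small_ball (1 / Num.sqrt 2) (1 / 12) Z] /\
  (gaussian_width A < 2%:E)%E /\
  forall (d' : measure_display) (T' : measurableType d')
         (P' : probability T' R) (X : 'I_n -> {RV P' >-> 'rV[R]_(4 ^ n).+1}),
  independent_copies Z X ->
  [/\ ((1 - expR (- 2 ^+ n))%:E <=
       P' [set w | inf_sqnorm (rows_mx X w) A = 0%E])%E,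
  (forall c1 c2 : R, 0 < c1 -> 0 < c2 -> 4 * c2 / c1 < n%:R ->
    ((1 - expR (- 2 ^+ n))%:E <=
       P' [set w | ~ width_bound c1 c2 (rows_mx X w) A])%E) &
  forall c1 c2 : R, measurable [set w | width_bound c1 c2 (rows_mx X w) A]].
Proof.
(* With M = 4N the width bound becomes 3/2 (1 + 1/4) = 15/8 < 2. *)
move=> n1; set N := (4 ^ n)%N; pose M : R := 4 * N%:R.
have N0 : (0 < N)%N by rewrite expn_gt0.
have M1 : 1 <= M by rewrite /M -natrM ler1n muln_gt0.
exists (thin_cone M); split; first by exists N, (generator M).
move=> A; pose a := @magnitude R N M.
have a0 := @magnitude_gt0 R N M M1.
exists _, _, (sign_law a), (sign_vec a); split.
  split.
  - exact: centered_sign_vec.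
  - exact: finite_covariance_sign_vec.
  - exact: polynomial_tails_sign_vec.
  - by apply: infinite_fourth_moments_sign_vec => k; rewrite gt_eqF.
  - by apply: small_ball_sign_vec; exact: magnitude_ge1.
have [r wA r2] : exists2 r : R, gaussian_width A = r%:E & `|r| < 2.
  have [||u [] //|u j [uC _]|r wA rle] := @gaussian_width_bound R N M A.
  - exact: lt_le_trans M1.
  - exact: thin_cone_sphere_neq0.
  - exact: thin_cone_coord.
  exists r => //; apply: le_lt_trans rle _; rewrite /M invfM mulrCA divff.
    by lra.
  by rewrite pnatr_eq0 -lt0n.
split; first by rewrite wA lte_fin (le_lt_trans (ler_norm _) r2).
move=> d' T' P' X copies.
have wbE c1 c2 w : width_bound c1 c2 (rows_mx X w) A <->
    ~ (inf_sqnorm (rows_mx X w) A < (c1 * n%:R - c2 * r ^+ 2)%:E)%E.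
  rewrite /width_bound wA -EFin_expe -EFinM -EFinB.
  by split=> [|/negP]; rewrite leNgt// => /negP.
have mwb c1 c2 : measurable [set w | ~ width_bound c1 c2 (rows_mx X w) A].
  rewrite (_ : mkset _ =
      [set w | (inf_sqnorm (rows_mx X w) A < (c1 * n%:R - c2 * r ^+ 2)%:E)%E]).
    exact: measurable_inf_sqnorm_lt.
  apply/seteqP; split=> w /=; first by move/wbE => /contrapT.
  by move=> h /wbE.
have m0 : measurable [set w | inf_sqnorm (rows_mx X w) A = 0%E].
  exact: measurable_inf_sqnorm_eq0.
have P0 : ((1 - expR (- 2 ^+ n))%:E <=
    P' [set w | inf_sqnorm (rows_mx X w) A = 0%E])%E.
  apply: le_trans (prob_antipodal a0 copies m0 _).
    by rewrite lee_fin lerB// one_minus_exp_le.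
  move=> t j w tj tw; apply: (inf_sqnorm_eq0 (j := j)).
    exact: generator_neq0.
  by apply: (antipodal_generator M1 tj) => i; rewrite rowK; exact: tw.
split=> //; last first.
  by move=> c1 c2; rewrite -[X in measurable X]setCK; apply: measurableC;
    exact: mwb.
move=> c1 c2 c10 c20 nc; apply: le_trans P0 _.
apply: le_measure; [exact: mem_set|by apply: mem_set; exact: mwb|].
(* Where the infimum is 0, [width_bound] would require c1 n <= c2 r^2, whereas r^2 <= 4 and c1 n > 4
   c2. *)
move=> w /= w0 /wbE; apply; rewrite w0 lte_fin subr_gt0.
move: nc; rewrite ltr_pdivrMr// [n%:R * _]mulrC; apply: le_lt_trans.
rewrite [leLHS]mulrC ler_pM2r// -[r ^+ 2]ger0_norm ?sqr_ge0// normrX.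
have -> : (4 : R) = 2 ^+ 2 by ring.
by rewrite lerXn2r ?nnegrE// ltW.
Qed.

Theorem corollary2p3 (R : realType) :
  ~ small_ball_to_width (1 / Num.sqrt 2 : R) (1 / 12)
  /\
  forall n : nat, (1 <= n)%N ->
  let p := (4 ^ n + 1)%N in
  exists C : set 'rV[R]_p, polyhedral_cone C /\
  let A := C `&` sphere p in
  exists (d : measure_display) (T : measurableType d) (P : probability T R)
         (Z : {RV P >-> 'rV[R]_p}),
  [/\ centered Z, finite_covariance Z, polynomial_tails Z,
      infinite_fourth_moments Z & small_ball (1 / Num.sqrt 2) (1 / 12) Z] /\
  (gaussian_width A < 2%:E)%E /\
  forall (d' : measure_display) (T' : measurableType d')
         (P' : probability T' R) (X : 'I_n -> {RV P' >-> 'rV[R]_p}),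
  independent_copies Z X ->
  ((1 - expR (- 2 ^+ n))%:E <= P' [set w | inf_sqnorm (rows_mx X w) A = 0%E])%E
  /\
  (forall c1 c2 : R, 0 < c1 -> 0 < c2 -> 4 * c2 / c1 < n%:R ->
    ((1 - expR (- 2 ^+ n))%:E <=
       P' [set w | ~ width_bound c1 c2 (rows_mx X w) A])%E).
Proof.
split; last first.
  move=> n n1 p; rewrite /p addn1.
  have [C [Cpoly [d [T [P [Z [HZ [wA HX]]]]]]]] := counterexample R n1.
  exists C; split=> //; exists d, T, P, Z; split=> //; split=> //.
  by move=> d' T' P' X /HX[].
move=> [c1 [c2 [q [c10 c20 q0 H]]]].
have [n [n1 nc qn]] : exists n :
  nat, [/\ (1 <= n)%N, 4 * c2 / c1 < n%:R & q n < 1 / 2].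
  have /cvgr_lt /(_ (1 / 2)) := q0; rewrite divr_gt0// => /(_ isT) [m _ qm].
  pose k := maxn m (Num.trunc (4 * c2 / c1)).+1.
  exists k; split; last by apply: qm; rewrite /= leq_maxl.
    by rewrite (leq_trans _ (leq_maxr _ _)).
  by apply: (lt_le_trans (truncnS_gt _)); rewrite ler_nat leq_maxr.
have [C [_ [d [T [P [Z [[_ _ _ _ sb] [_ HX]]]]]]]] := counterexample R n1.
have [d' [T' [P' [X copies]]]] := independent_copies_exist Z n.
have [_ /(_ _ _ c10 c20 nc) far mwb] := HX _ _ _ _ copies.
have near_ := H _ _ _ _ _ _ _ _ _ _ _ sb (@subIsetr _ C _) copies.
move: far; rewrite (_ : mkset _ =
  ~` [set w | width_bound c1 c2 (rows_mx X w) (C `&` sphere (4 ^ n).+1)])//.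
rewrite probability_setC//.
move: near_; set Q := P' _; have Qfin :
  Q \is a fin_num by exact: fin_num_measure.
rewrite -(fineK Qfin) -EFinB !lee_fin => Q1 Q2.
(* The assertion gives Q >= 1 - q_n > 1/2, while the example gives 1 - Q >= 1 - exp(-2^n) >= 1/2, a
   contradiction. *)
have : expR (- 2 ^+ n) <= 1 / 2 :> R.
  rewrite expRN div1r lef_pV2 ?posrE ?expR_gt0//.
  apply: le_trans (expR_ge1Dx _); rewrite -[leLHS]/(1 + 1) lerD2l.
  by rewrite exprn_ege1// ler1n.
lra.
Qed.
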